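(* Let $A \subset \mathbb{R}$ be finite and nonempty, and write $|A+A| = K|A|$. Then \[ |AAA| \gtrsim \frac{|A|^{2+\frac{1}{392}}}{K^{\frac{125}{56}}}. \]
   Context: $A+A := \{a+b : a,b \in A\}$; $AAA := \{a_1a_2a_3 : a_1,a_2,a_3 \in A\}$. For positive quantities, $X \gtrsim Y$ means that there exist absolute constants $C>0$ and $c>0$ such that $X \geq C\, Y/(\log X)^c$ (logarithms base $2$). *)

(* Defs.v *)
From mathcomp Require Import all_boot all_order all_algebra finmap.
From mathcomp Require Import all_classical all_reals all_analysis.

Set Implicit Arguments.
Unset Strict Implicit.
Unset Printing Implicit Defensive.

Import Order.TTheory GRing.Theory Num.Theory.
Local Open Scope ring_scope.

Definition sumset (R : realType) (A B : {fset R}) : {fset R} :=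
  [fset (a + b)%R | a in A, b in B]%fset.

Definition triple_prodset (R : realType) (A B D : {fset R}) : {fset R} :=
  [fset (p * d)%R | p in [fset (a * b)%R | a in A, b in B]%fset, d in D]%fset.

Definition log2 (R : realType) (x : R) : R := ln x / ln 2.

(* [X >~ Y] with its two constants made explicit, so that a statement can
   quantify them before the data on which X and Y depend.  When X is the
   cardinality of a nonempty finite set, log2 X = 0 only for X = 1, where the
   quotient, not defined mathematically, is 0 by convention (0^-1 = 0); for
   X >= 2 one has log2 X >= 1. *)
Definition gtrsim_with (R : realType) (C c X Y : R) : Prop :=
  X >= C * Y / (log2 X) `^ c.

(* Main.v *)
(* After passing to the positive part of A (or of -A), put L = ln A, n = |A|,
   s = |A+A|, P = |AA|, q = |AAA|.

   Squeezing: pigeonholing the consecutive gaps of A, and then those of the set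
   of left endpoints of a popular gap d, gives d, e > 0 and a large B' such that
   the intervals [b, b+d] have no point of A inside, and the [b, b+e] none of
   the first-level endpoints.  Since the first two finite differences of ln are
   monotone, the sums ln b + (ln(b'+e+d) - ln(b'+e))
   + (second difference at b'') with b <= b' <= b'' in B' are nested in
   disjoint intervals, hence distinct, and they all lie in 4L - 3L.  So
   n^12 <= O(|4L-3L| |A+A-A|^9), and Pluennecke-Ruzsa, applied to A in the
   additive group and to L and L+L, turns this into n^30 P^6 <= O(s^27 q^7).

   Solymosi: n^4 <= 2 P s^2 (1 + ln n).  Eliminating P in two ways (sixth power
   into the squeezing bound, and P <= q) and taking the weighted geometric mean
   with weights 1/56 and 55/56 of the two resulting lower bounds for q gives the
   claim. *)
Require Import Defs.
From mathcomp Require Import all_boot all_order all_algebra finmap.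
From mathcomp Require Import all_classical all_reals all_analysis.
From mathcomp Require Import zify ring lra.

Set Implicit Arguments.
Unset Strict Implicit.
Unset Printing Implicit Defensive.

Import Order.TTheory GRing.Theory Num.Theory.
Local Open Scope ring_scope.

(** * Injections and fibre counts for finite sets *)

Lemma leq_card_inj (T U : choiceType) (f : T -> U) (A : {fset T})
    (B : {fset U}) :
  (forall x, x \in A -> f x \in B) -> {in A &, injective f} ->
  (#|` A| <= #|` B|)%N.
Proof.
move=> fAB f_inj; rewrite -(card_in_imfset imfset_key f_inj).
by apply/fsubset_leq_card/fsubsetP => _ /imfsetP[x xA ->]; exact: fAB.
Qed.

Lemma card_fsetM (T U : choiceType) (A : {fset T}) (B : {fset U}) :
  #|` (A `*` B)%fset| = (#|` A| * #|` B|)%N.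
Proof.
rewrite card_fset_sum1 big_imfset2; last by move=> [a b] [c d] _ _ [-> ->].
by rewrite /= sum1_size big_const_seq count_predT iter_addn_0 mulnC.
Qed.

Lemma card_fibers (T U : choiceType) (f : T -> U) (A : {fset T})
    (B : {fset U}) : (forall x, x \in A -> f x \in B) ->
  #|` A| = (\sum_(y <- B) #|` [fset x in A | f x == y]%fset|)%N.
Proof.
move=> fAB; rewrite card_fset_sum1 (partition_big_imfset _ f) /=.
under eq_bigr => y _ do rewrite big_fset_condE -card_fset_sum1.
apply: big_fset_incl; first by apply/fsubsetP => _ /imfsetP[x xA ->]; exact: fAB.
move=> y _ yNf; apply/eqP; rewrite cardfs_eq0; apply/eqP/fsetP => x.
rewrite !inE; apply/negP => /andP[xA /eqP fxy].
by move/negP: yNf; apply; rewrite -fxy in_imfset.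
Qed.

Lemma leq_card_fibers (T U : choiceType) (f : T -> U) (A : {fset T})
    (B : {fset U}) (k : nat) : (forall x, x \in A -> f x \in B) ->
  (forall y, y \in B -> #|` [fset x in A | f x == y]%fset| <= k)%N ->
  (#|` A| <= #|` B| * k)%N.
Proof.
move=> fAB fk; rewrite (card_fibers fAB).
rewrite mulnC -iter_addn_0 -(count_predT B) -big_const_seq.
by rewrite big_seq [leqRHS]big_seq; apply: leq_sum.
Qed.

(** * Sumsets and difference sets in an abelian group *)

Definition addset (V : zmodType) (A B : {fset V}) : {fset V} :=
  [fset (a + b)%R | a in A, b in B]%fset.

Definition diffset (V : zmodType) (A B : {fset V}) : {fset V} :=
  [fset (a - b)%R | a in A, b in B]%fset.

Fixpoint sumsn (V : zmodType) (k : nat) (A : {fset V}) : {fset V} :=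
  if k is k'.+1 then addset A (sumsn k' A) else [fset 0]%fset.

Lemma addsetP (V : zmodType) (A B : {fset V}) (x : V) :
  reflect (exists a b, [/\ a \in A, b \in B & x = a + b]) (x \in addset A B).
Proof.
apply: (iffP idP) => [/imfset2P[a aA [b bB ->]]|[a [b [aA bB ->]]]].
  by exists a, b.
by apply: in_imfset2.
Qed.

Lemma mem_addset (V : zmodType) (A B : {fset V}) (a b : V) :
  a \in A -> b \in B -> a + b \in addset A B.
Proof. by move=> aA bB; apply/addsetP; exists a, b. Qed.

Lemma diffsetP (V : zmodType) (A B : {fset V}) (x : V) :
  reflect (exists a b, [/\ a \in A, b \in B & x = a - b]) (x \in diffset A B).
Proof.
apply: (iffP idP) => [/imfset2P[a aA [b bB ->]]|[a [b [aA bB ->]]]].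
  by exists a, b.
by apply: in_imfset2.
Qed.

Lemma mem_diffset (V : zmodType) (A B : {fset V}) (a b : V) :
  a \in A -> b \in B -> a - b \in diffset A B.
Proof. by move=> aA bB; apply/diffsetP; exists a, b. Qed.

Lemma addsetA (V : zmodType) : associative (@addset V).
Proof.
move=> A B C; apply/fsetP => x; apply/addsetP/addsetP.
  move=> [a [_ [aA /addsetP[b [c [bB cC ->]]] ->]]].
  by exists (a + b), c; rewrite addrA mem_addset.
move=> [_ [c [/addsetP[a [b [aA bB ->]]] cC ->]]].
by exists a, (b + c); rewrite addrA mem_addset.
Qed.

Lemma addset0r (V : zmodType) (A : {fset V}) : addset A [fset 0]%fset = A.
Proof.
apply/fsetP => x; apply/addsetP/idP.
  by move=> [a [b [aA]]]; rewrite inE => /eqP -> ->; rewrite addr0.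
by move=> xA; exists x, 0; rewrite xA inE eqxx addr0.
Qed.

Lemma addsetS (V : zmodType) (A B C D : {fset V}) :
  (A `<=` C -> B `<=` D -> addset A B `<=` addset C D)%fset.
Proof.
move=> /fsubsetP AC /fsubsetP BD; apply/fsubsetP => x /addsetP[a [b [aA bB ->]]].
by apply: mem_addset; [exact: AC|exact: BD].
Qed.

Lemma diffsetS (V : zmodType) (A B C D : {fset V}) :
  (A `<=` C -> B `<=` D -> diffset A B `<=` diffset C D)%fset.
Proof.
move=> /fsubsetP AC /fsubsetP BD; apply/fsubsetP => x /diffsetP[a [b [aA bB ->]]].
by apply: mem_diffset; [exact: AC|exact: BD].
Qed.

Lemma addset_neq0 (V : zmodType) (A B : {fset V}) :
  A != fset0 -> B != fset0 -> addset A B != fset0.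
Proof.
move=> /fset0Pn[a aA] /fset0Pn[b bB]; apply/fset0Pn.
by exists (a + b); exact: mem_addset.
Qed.

Lemma card_addset1 (V : zmodType) (A : {fset V}) (c : V) :
  #|` addset A [fset c]%fset| = #|` A|.
Proof.
apply/eqP; rewrite eqn_leq; apply/andP; split.
  apply: (@leq_card_inj _ _ (fun x => x - c)); last by move=> x y _ _ /addIr.
  by move=> x /addsetP[a [b [aA]]]; rewrite inE => /eqP -> ->; rewrite addrK.
apply: (@leq_card_inj _ _ (fun x => x + c)); last by move=> x y _ _ /addIr.
by move=> x xA; rewrite mem_addset// inE.
Qed.

Lemma leq_card_addset (V : zmodType) (A B : {fset V}) :
  B != fset0 -> (#|` A| <= #|` addset A B|)%N.
Proof.
move=> /fset0Pn[b bB]; rewrite -(card_addset1 A b); apply: fsubset_leq_card.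
by apply: addsetS; rewrite // fsub1set.
Qed.

(** * Plünnecke-Ruzsa inequalities *)

(* Petridis' induction on C; Z collects the x for which x + A + c brings
   nothing new to X + A + C. *)
Lemma petridis (V : zmodType) (X A C : {fset V}) :
  (forall Z, (Z `<=` X)%fset ->
    (#|` addset X A| * #|` Z| <= #|` addset Z A| * #|` X|)%N) ->
  (#|` addset (addset X A) C| * #|` X| <= #|` addset X A| * #|` addset X C|)%N.
Proof.
move=> Xmin; elim/fset1U_rect: C => [|c C cNC IH].
  suff -> : addset (addset X A) fset0 = fset0 by rewrite cardfs0.
  by apply/fsetP => x; rewrite inE; apply/negP => /addsetP[a [b []]].
pose XA := addset X A.
pose Z := [fset x in X | (addset (addset [fset x] A) [fset c] `<=` addset XA C)%fset]%fset.
have ZX : (Z `<=` X)%fset by apply/fsubsetP => x; rewrite !inE => /andP[].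
have ZA : (addset Z A `<=` XA)%fset by exact: addsetS.
(* If w is in Z + A, then w + c already lies in X + A + C, so only the translates of (X + A) \ (Z +
   A) can be new. *)
have le1 : (#|` addset XA (c |` C)%fset| <=
    #|` addset XA C| + (#|` XA| - #|` addset Z A|))%N.
  rewrite -cardfsDS// -(card_addset1 (XA `\` _)%fset c).
  apply: leq_trans (leq_card_fsetU _ _).1; apply: fsubset_leq_card.
  apply/fsubsetP => y /addsetP[w [d [wXA]]].
  rewrite !inE => /orP[/eqP ->|dC] ->; last by rewrite mem_addset.
  have [wZ|wZ] := boolP (w \in addset Z A).
    case/addsetP: wZ => z [a [zZ aA ->]]; apply/orP; left.
    move: zZ; rewrite !inE => /andP[_ /fsubsetP]; apply.
    by rewrite mem_addset ?inE// mem_addset ?inE.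
  by apply/orP; right; rewrite mem_addset ?inE// wZ.
(* A coincidence x + c = x' + c'' with c'' in C puts x + A + c inside X + A + C, so that x is in Z;
   hence the translates of X \ Z are all new. *)
have le2 : (#|` addset X C| + (#|` X| - #|` Z|) <= #|` addset X (c |` C)%fset|)%N.
  rewrite -cardfsDS// -(card_addset1 (X `\` _)%fset c).
  have disj : [disjoint addset X C & addset (X `\` Z) [fset c]]%fset.
    apply/fdisjointP_sym => y /addsetP[x [c' []]].
    rewrite in_fset1 in_fsetD => /andP[xNZ xX] /eqP -> ->.
    apply/negP => /addsetP[x' [c'' [x'X c''C e]]].
    move/negP: xNZ; apply; rewrite !inE xX /=; apply/fsubsetP => y'.
    move=> /addsetP[w [c1 [/addsetP[x1 [a [+ aA ->]]]]]].
    rewrite !in_fset1 => /eqP -> /eqP -> ->.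
    by rewrite addrAC e addrAC mem_addset ?mem_addset.
  have := (leq_card_fsetU (addset X C) (addset (X `\` Z) [fset c])%fset).2.
  rewrite disj => /eqP <-; apply: fsubset_leq_card; rewrite fsubUset.
  rewrite !addsetS// ?fsubsetUr// ?fsubsetUl//; first exact: fsubsetDl.
(* Minimality at Z gives |X| (|X + A| - |Z + A|) <= |X + A| (|X| - |Z|), which compares the two
   increments. *)
have := Xmin _ ZX; have := fsubset_leq_card ZX; have := fsubset_leq_card ZA.
move: IH le1 le2; rewrite -/XA => IH le1 le2 ZAle Zle Zmin.
nia.
Qed.

(** The ratio |X + A| / |X| has to be minimal only among subsets of X, so a descent suffices: when B
    fails, a proper nonempty subset has a smaller ratio, and strong induction applies to it. *)
Lemma exists_minimizer (V : zmodType) (A B : {fset V}) : B != fset0 ->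
  exists X, [/\ (X `<=` B)%fset, X != fset0,
    (#|` addset X A| * #|` B| <= #|` addset B A| * #|` X|)%N &
    forall Z, (Z `<=` X)%fset ->
    (#|` addset X A| * #|` Z| <= #|` addset Z A| * #|` X|)%N].
Proof.
elim/finSet_rect: B => B IH B0.
have [minB|] := pselect (forall Z, (Z `<=` B)%fset ->
  (#|` addset B A| * #|` Z| <= #|` addset Z A| * #|` B|)%N); first by exists B.
move=> /existsNP[Z /not_implyP[ZB /negP]]; rewrite -ltnNge => Zlt.
have Z0 : Z != fset0 by apply: contraTneq Zlt => ->; rewrite cardfs0 muln0.
have ZpB : (Z `<` B)%fset.
  by rewrite fproperEneq ZB andbT; apply: contraTneq Zlt => ->; rewrite ltnn.
have [X [XZ X0 XZle Xmin]] := IH _ ZpB Z0.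
exists X; split => //; first exact: fsubset_trans ZB.
have Zgt0 : (0 < #|` Z|)%N by rewrite cardfs_gt0.
rewrite -(leq_pmul2r Zgt0).
rewrite mulnAC (leq_trans (leq_mul XZle (leqnn _)))//.
by rewrite mulnAC [leqRHS]mulnAC leq_mul// ltnW.
Qed.

(** One X serves all k, so that bounds for two values of k can be combined. Each application of
    [petridis], with [sumsn k A] as third set, costs a factor |B + A| / |B|. *)
Lemma plunnecke (V : zmodType) (A B : {fset V}) : B != fset0 ->
  exists X, [/\ (X `<=` B)%fset, X != fset0 & forall k,
    (#|` addset X (sumsn k A)| * #|` B| ^ k <= #|` addset B A| ^ k * #|` X|)%N].
Proof.
move=> /(exists_minimizer A)[X [XB X0 Xle Xmin]]; exists X; split => // k.
have Xgt0 : (0 < #|` X|)%N by rewrite cardfs_gt0.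
elim: k => [|k IH] /=; first by rewrite addset0r !expn0 muln1 mul1n.
have := petridis (sumsn k A) Xmin; rewrite addsetA => le1.
rewrite -(leq_pmul2r Xgt0) !expnS.
rewrite mulnAC (leq_trans (leq_mul le1 (leqnn _)))//.
by rewrite mulnACA (leq_trans (leq_mul Xle IH))// mulnACA mulnA.
Qed.

(** Fix a representation d = y - z of each difference. The pair (x + y, x + z) gives back d as the
    difference of its coordinates, and then x. *)
Lemma ruzsa_triangle (V : zmodType) (X Y Z : {fset V}) :
  (#|` diffset Y Z| * #|` X| <= #|` addset X Y| * #|` addset X Z|)%N.
Proof.
have /choice[yz yzP] : forall d, exists p : V * V, d \in diffset Y Z ->
    [/\ p.1 \in Y, p.2 \in Z & d = p.1 - p.2].
  move=> d; have [dYZ|] := boolP (d \in diffset Y Z); last by exists (0, 0).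
  by have /diffsetP[y [z yzd]] := dYZ; exists (y, z).
rewrite -!card_fsetM.
apply: (@leq_card_inj _ _ (fun p => (p.2 + (yz p.1).1, p.2 + (yz p.1).2))).
  move=> [d x]; rewrite !in_fsetM /= => /andP[/yzP[y1 z1 _] xX].
  by rewrite !mem_addset.
move=> [d x] [d' x']; rewrite !in_fsetM /= => /andP[dYZ xX] /andP[dYZ' xX'].
case=> e1 e2; have dd' : d = d'.
  have [_ _ ->] := yzP _ dYZ; have [_ _ ->] := yzP _ dYZ'.
  have shift (u v w : V) : v - w = (u + v) - (u + w).
    by rewrite opprD addrACA subrr add0r.
  by rewrite (shift x) e1 e2 -shift.
by move: e1; rewrite dd' => /addIr ->.
Qed.

(** Ruzsa's triangle inequality through the X of [plunnecke]: of the two factors |X| that arise, one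
    cancels and the other is at most |B|. *)
Lemma plunnecke_ruzsa (V : zmodType) (A B : {fset V}) (k l : nat) :
  B != fset0 ->
  (#|` diffset (sumsn k A) (sumsn l A)| * #|` B| ^ (k + l)
    <= #|` addset B A| ^ (k + l) * #|` B|)%N.
Proof.
move=> /[dup] B0 /(plunnecke A)[X [XB X0 Xle]].
have Xgt0 : (0 < #|` X|)%N by rewrite cardfs_gt0.
have XleB := fsubset_leq_card XB.
rewrite -(leq_pmul2r Xgt0) !expnD; have := leq_mul (Xle k) (Xle l).
have := ruzsa_triangle X (sumsn k A) (sumsn l A).
set t := #|` diffset _ _|; set u := #|` addset X (sumsn k A)|.
set v := #|` addset X (sumsn l A)|; set b := #|` B|; set s := #|` addset B A|.
move=> le1 le2; rewrite mulnAC (leq_trans (leq_mul le1 (leqnn _)))// mulnACA.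
by rewrite (leq_trans le2)// mulnACA mulnA leq_mul// leq_mul.
Qed.

(** * Extrema, successors and ordered tuples in finite sets *)

Lemma in_fset_filter (T : choiceType) (A : {fset T}) (P : pred T) (x : T) :
  (x \in [fset y in A | P y]%fset) = (x \in A) && P x.
Proof. by rewrite !inE. Qed.

(** Stated for total preorders, to serve both the order of the elements and the comparison of gaps
    by popularity. *)
Lemma fset_extremum (T : choiceType) (r : rel T) (A : {fset T}) :
  total r -> transitive r -> A != fset0 ->
  exists2 m, m \in A & forall x, x \in A -> r m x.
Proof.
move=> r_total r_trans; have rxx x : r x x by have := r_total x x; rewrite orbb.
elim/fset1U_rect: A => [|x A _ IH _]; first by rewrite eqxx.
have [->|A0] := eqVneq (A : {fset T}) fset0.
  exists x; first by rewrite !inE eqxx.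
  by move=> y; rewrite !inE orbF => /eqP ->.
have [m mA mr] := IH A0; have [xm|mx] := orP (r_total x m).
  exists x; first by rewrite !inE eqxx.
  by move=> y /fset1UP[->//|/mr]; exact: r_trans.
exists m; first by rewrite !inE mA orbT.
by move=> y /fset1UP[->//|/mr].
Qed.

Lemma fset_successor (d : Order.disp_t) (T : orderType d) (A : {fset T}) :
  A != fset0 -> exists (M : T) (next : T -> T),
    [/\ M \in A, forall a, a \in A -> (a <= M)%O &
      forall a, a \in A -> a != M -> [/\ next a \in A, (a < next a)%O &
        forall b, b \in A -> (a < b)%O -> (next a <= b)%O]].
Proof.
move=> A0; have [M MA Mmax] := fset_extremum (@ge_total _ T) ge_trans A0.
have {}Mmax x : x \in A -> (x <= M)%O by exact: Mmax.
have /choice[next nextP] : forall a, exists y, a \in A -> a != M ->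
    [/\ y \in A, (a < y)%O & forall b, b \in A -> (a < b)%O -> (y <= b)%O].
  move=> a; have [/andP[aA aM]|h] := boolP ((a \in A) && (a != M)); last first.
    by exists a => aA aM; move: h; rewrite aA aM.
  have A_gt0 : [fset x in A | (a < x)%O]%fset != fset0.
    by apply/fset0Pn; exists M; rewrite !inE MA /= lt_neqAle aM Mmax.
  have [m] := fset_extremum (@le_total _ T) le_trans A_gt0.
  rewrite !inE => /andP[mA am] mmin; exists m => _ _; split => // b bA ab.
  by apply: mmin; rewrite !inE bA.
by exists M, next; split.
Qed.

Lemma card_total_pairs (T : choiceType) (r : rel T) (A : {fset T}) : total r ->
  (#|` A| ^ 2 <= 2 * #|` [fset p in (A `*` A)%fset | r p.1 p.2]%fset|)%N.
Proof.
move=> r_total; set S := [fset p in _ | _]%fset.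
pose swap (p : T * T) := (p.2, p.1).
rewrite -mulnn -card_fsetM mul2n -addnn.
have leS : (#|` [fset swap p | p in S]%fset| <= #|` S|)%N.
  exact: leq_imfset_card.
apply: leq_trans (leq_add (leqnn _) leS).
apply: leq_trans (leq_card_fsetU _ _).1.
apply/fsubset_leq_card/fsubsetP => -[a b]; rewrite !inE /= => /andP[aA bA].
have [rab|rba] := orP (r_total a b); first by rewrite aA bA rab.
apply/orP; right; apply/imfsetP; exists (b, a) => //=.
by rewrite !inE /= aA bA rba.
Qed.

(** The six rearrangements of the sorted triples cover the cube. *)
Lemma card_sorted_triples (d : Order.disp_t) (T : orderType d) (A : {fset T}) :
  (#|` A| ^ 3 <= 6 * #|` [fset t in (A `*` A `*` A)%fset |
    (t.1.1 <= t.1.2)%O && (t.1.2 <= t.2)%O]%fset|)%N.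
Proof.
set S := [fset t in _ | _]%fset; pose f (g : T -> T -> T -> T * T * T) (t : T * T * T) :=
  g t.1.1 t.1.2 t.2.
have cardf g : (#|` [fset f g t | t in S]%fset| <= #|` S|)%N.
  exact: leq_imfset_card.
have cardU : forall (X Y : {fset T * T * T}) m,
    (#|` X| <= m * #|` S| -> #|` Y| <= #|` S| ->
     #|` (X `|` Y)%fset| <= m.+1 * #|` S|)%N.
  move=> X Y m Xm Ym; apply: leq_trans (leq_card_fsetU _ _).1 _.
  by rewrite mulSn addnC leq_add.
have -> : (#|` A| ^ 3 = #|` (A `*` A `*` A)%fset|)%N.
  by rewrite !card_fsetM; ring.
apply: (@leq_trans #|` ([fset f (fun x y z => (x, y, z)) t | t in S] `|`
  [fset f (fun x y z => (x, z, y)) t | t in S] `|`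
  [fset f (fun x y z => (y, x, z)) t | t in S] `|`
  [fset f (fun x y z => (y, z, x)) t | t in S] `|`
  [fset f (fun x y z => (z, x, y)) t | t in S] `|`
  [fset f (fun x y z => (z, y, x)) t | t in S])%fset|); last first.
  by do 5![apply: (@cardU _ _ _) => //]; rewrite mul1n.
apply/fsubset_leq_card/fsubsetP => -[[a b] c]; rewrite !in_fsetM /=.
move=> /andP[/andP[aA bA] cA].
have mem g x y z : x \in A -> y \in A -> z \in A -> (x <= y)%O -> (y <= z)%O ->
    g x y z \in [fset f g t | t in S]%fset.
  move=> xA yA zA xy yz; apply/imfsetP; exists (x, y, z) => //=.
  by rewrite !inE /= xA yA zA xy.
have {}mem g x y z w : w = g x y z -> x \in A -> y \in A -> z \in A ->
  (x <= y)%O -> (y <= z)%O -> w \in [fset f g t | t in S]%fset.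
  by move=> ->; exact: mem.
rewrite !in_fsetU.
have [ab|/ltW ba] := leP a b; have [bc|/ltW cb] := leP b c;
  have [ac|/ltW ca] := leP a c.
- by rewrite (@mem (fun x y z => (x, y, z)) a b c).
- by rewrite (@mem (fun x y z => (x, y, z)) a b c).
- by rewrite (@mem (fun x y z => (x, z, y)) a c b) ?orbT.
- by rewrite (@mem (fun x y z => (y, z, x)) c a b) ?orbT.
- by rewrite (@mem (fun x y z => (y, x, z)) b a c) ?orbT.
- by rewrite (@mem (fun x y z => (z, x, y)) b c a) ?orbT.
- by rewrite (@mem (fun x y z => (z, y, x)) c b a) ?orbT.
- by rewrite (@mem (fun x y z => (z, y, x)) c b a) ?orbT.
Qed.

(** * Squeezing: popular gaps and finite differences of the logarithm *)

(* The map (a, a') |-> a + gap a', on pairs with gap a' <= gap a, lands in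
   A+A-A, determines a, and hence has fibres no larger than the most frequent
   gap value d. *)
Lemma popular_gap (R : realDomainType) (A : {fset R}) : A != fset0 ->
  exists (d : R) (B : {fset R}), [/\ 0 < d, (B `<=` A)%fset,
    forall b, b \in B -> b + d \in A,
    forall b a, b \in B -> a \in A -> b < a -> b + d <= a &
    (#|` A|.-1 ^ 2 <= 2 * (#|` B| * #|` diffset (addset A A) A|))%N].
Proof.
move=> /fset_successor[M [next [MA Mmax nextP]]].
pose A' := (A `\ M)%fset; pose gap a := next a - a.
have A'P a : a \in A' -> [/\ a \in A, next a \in A, 0 < gap a &
    forall b, b \in A -> a < b -> next a <= b].
  rewrite !inE => /andP[aM aA]; have [nA an nmin] := nextP _ aA aM.
  by split => //; rewrite subr_gt0.
have cardA' : #|` A'| = #|` A|.-1 by rewrite (cardfsD1 M A) MA.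
have [A'0|A'0] := eqVneq A' fset0.
  exists 1, fset0; rewrite fsub0set ltr01 -cardA' A'0 cardfs0.
  by split => // b; rewrite inE.
pose level a := [fset x in A' | gap x == gap a]%fset.
have [a0 a0A' a0max] := @fset_extremum _
  (fun x y => (#|` level y| <= #|` level x|)%N) _
  (fun x y => leq_total _ _) (fun y x z yx xz => leq_trans xz yx) A'0.
have [a0A na0A gap0 a0min] := A'P _ a0A'.
exists (gap a0), (level a0); split => //.
- apply/fsubsetP => b; rewrite !inE => /andP[/andP[_ bA] _]; exact: bA.
- move=> b; rewrite in_fset_filter => /andP[/= /A'P[_ nbA _ _] /eqP <-].
  by rewrite /gap subrKC.
- move=> b a; rewrite in_fset_filter => /andP[/= /A'P[_ _ _ bmin] /eqP <-] aA ba.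
  by rewrite /gap subrKC bmin.
rewrite -cardA'.
have gap_total : total (fun x y => gap y <= gap x) by move=> x y; exact: le_total.
apply: leq_trans (card_total_pairs _ gap_total) _; rewrite leq_mul2l /= mulnC.
apply: (@leq_card_fibers _ _ (fun p => p.1 + next p.2 - p.2)).
  move=> [a b]; rewrite in_fset_filter in_fsetM /= => /andP[/andP[/A'P[aA _ _ _]]].
  by move=> /A'P[bA nbA _ _] _; rewrite mem_diffset// mem_addset.
move=> y _; set S := [fset p in _ | _]%fset; set F := (X in (#|` X| <= _)%N).
have [->|/fset0Pn[p0]] := eqVneq F fset0; first by rewrite cardfs0.
have FP p : p \in F -> [/\ p.1 \in A', p.2 \in A', p.1 < y, y <= next p.1 &
    y = p.1 + gap p.2].
  rewrite !in_fset_filter in_fsetM => /andP[/andP[/andP[p1 p2] le12]].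
  move=> /eqP yE; have [_ _ gp _] := A'P _ p2.
  have {}yE : y = p.1 + gap p.2 by rewrite -yE addrA.
  split => //; first by rewrite yE ltrDl.
  by rewrite yE -lerBrDl.
move=> /[dup] p0F /FP[p01 p02 p0y yp0 yE].
(* The intervals (p.1, next p.1] are disjoint, and y lies in that of p.1 because gap p.2 <= gap
   p.1. *)
have F1 p : p \in F -> p.1 = p0.1.
  move=> /FP[p1 p2 py yp _].
  have [pA npA _ pmin] := A'P _ p1; have [p0A np0A _ p0min] := A'P _ p01.
  apply/eqP; rewrite eq_le !leNgt; apply/andP; split; apply/negP => lt.
    by have := lt_le_trans py (le_trans yp0 (p0min _ pA lt)); rewrite ltxx.
  by have := lt_le_trans p0y (le_trans yp (pmin _ p0A lt)); rewrite ltxx.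
(* With p.1 fixed, gap p.2 = y - p.1 is fixed too, so the fibre injects into one level set. *)
apply: leq_trans (a0max _ p02); apply: (@leq_card_inj _ _ (fun p => p.2)).
  move=> p /[dup] pF /FP[p1 p2 _ _ yE']; rewrite in_fset_filter p2 /=.
  by apply/eqP; apply: (addrI p0.1); rewrite -yE yE' (F1 _ pF).
move=> [a b] [a' b'] /F1/= -> /F1/= -> -> //.
Qed.

(** A sorted triple is recovered in three stages: [W] lies in (x, x + d], which fixes x; [U y z]
    lies in (g (y + e), g y], which fixes y; strict monotonicity of [h] fixes z. *)
Lemma squeeze (R : realType) (A B B' : {fset R}) (d e : R) :
  (forall a, a \in A -> 0 < a) -> 0 < d -> 0 < e ->
  (B `<=` A)%fset -> (B' `<=` B)%fset ->
  (forall b, b \in B -> b + d \in A) ->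
  (forall b, b \in B' -> b + e \in B) ->
  (forall b a, b \in B -> a \in A -> b < a -> b + d <= a) ->
  (forall b a, b \in B' -> a \in B -> b < a -> b + e <= a) ->
  let L := [fset ln a | a in A]%fset in
  (#|` B'| ^ 3 <= 6 * #|` diffset (sumsn 4 L) (sumsn 3 L)|)%N.
Proof.
move=> Agt0 d_gt0 e_gt0 /fsubsetP BA /fsubsetP B'B BdA B'eB Bgap B'gap.
set L := [fset ln a | a in A]%fset; cbv zeta.
pose g x := (x + d) / x; pose h x := g x / g (x + e).
have gE x : 0 < x -> g x = 1 + d / x by move=> x0; rewrite /g; field; lra.
have hE x : 0 < x -> h x = 1 + d * e / (x * (x + e + d)).
  by move=> x0; rewrite /h /g; field; rewrite !gt_eqF//; lra.
have g_gt0 x : 0 < x -> 0 < g x by move=> x0; rewrite divr_gt0// addr_gt0.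
have gM x y : 0 < x -> x <= y -> g y <= g x.
  move=> x0 xy; have y0 := lt_le_trans x0 xy; rewrite !gE// lerD2l.
  by rewrite ler_pM2l// lef_pV2.
have h_lt x y : 0 < x -> x < y -> h y < h x.
  move=> x0 xy; have y0 := lt_trans x0 xy; rewrite !hE// ltrD2l.
  rewrite ltr_pM2l ?mulr_gt0// ltf_pV2 ?posrE ?mulr_gt0 ?addr_gt0//.
  by rewrite ltr_pM ?addr_ge0 ?ltW//; lra.
have h_le x y : 0 < x -> x <= y -> h y <= h x.
  by move=> x0; rewrite le_eqVlt => /predU1P[->//|/(h_lt _ _ x0)/ltW].
have h_gt1 x : 0 < x -> 1 < h x.
  by move=> x0; rewrite hE// ltrDl divr_gt0 ?mulr_gt0 ?addr_gt0.
have h_gt0 x : 0 < x -> 0 < h x by move=> /h_gt1; apply: lt_trans.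
have B'gt0 b : b \in B' -> 0 < b by move=> /B'B/BA/Agt0.
(* h, g and W are the exponentials of the second difference, of the first
   difference and of the sum attached to a triple. *)
pose U (y z : R) := g (y + e) * h z.
have U_gt y z : 0 < y -> 0 < z -> g (y + e) < U y z.
  by move=> y0 z0; rewrite /U ltr_pMr ?h_gt1// g_gt0 ?addr_gt0.
(* At z = y the product telescopes to g y, and [h] decreases; this is where y <= z is used. *)
have U_le y z : 0 < y -> y <= z -> U y z <= g y.
  move=> y0 yz; have -> : g y = U y y.
    by rewrite /U /h mulrC divfK// gt_eqF// g_gt0// addr_gt0.
  by rewrite /U ler_pM2l ?h_le// g_gt0// addr_gt0.
pose W (t : R * R * R) := t.1.1 * U t.1.2 t.2.
apply: leq_trans (card_sorted_triples B') _; rewrite leq_mul2l /=.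
apply: (@leq_card_inj _ _ (fun t => ln (W t))).
  move=> [[x y] z]; rewrite in_fset_filter in_fsetM /= in_fsetM /=.
  move=> /andP[/andP[/andP[xB yB] zB] _].
  have LA a : a \in A -> ln a \in L by move=> aA; exact: in_imfset.
  have x0 := B'gt0 _ xB; have y0 := B'gt0 _ yB; have z0 := B'gt0 _ zB.
  (* Each argument is b, b + d, b + e or b + e + d with b in B', hence in A; the final zeros come
     from the base case of [sumsn]. *)
  have -> : ln (W (x, y, z)) =
      (ln x + (ln (y + e + d) + (ln (z + d) + (ln (z + e) + 0)))) -
      (ln (y + e) + (ln z + (ln (z + e + d) + 0))).
    have ln_g u : 0 < u -> ln (g u) = ln (u + d) - ln u.
      by move=> u0; rewrite ln_div// posrE addr_gt0.
    have ln_h u : 0 < u -> ln (h u) = ln (g u) - ln (g (u + e)).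
      by move=> u0; rewrite ln_div ?posrE ?g_gt0 ?addr_gt0.
    have gye := g_gt0 _ (addr_gt0 y0 e_gt0); have hz := h_gt0 _ z0.
    rewrite /W /= !addr0 lnM ?posrE ?(mulr_gt0 gye hz)// lnM ?posrE//.
    rewrite ln_h// !ln_g ?addr_gt0//.
    ring.
  apply: mem_diffset; (do !apply: mem_addset); rewrite ?inE//; apply: LA.
  - by apply/BA/B'B.
  - by apply/BdA/B'eB.
  - by apply/BdA/B'B.
  - by apply/BA/B'eB.
  - by apply/BA/B'eB.
  - by apply/BA/B'B.
  - by apply/BdA/B'eB.
have inP t : t \in [fset t in (B' `*` B' `*` B')%fset |
    (t.1.1 <= t.1.2)%O && (t.1.2 <= t.2)%O]%fset ->
    [/\ t.1.1 \in B', t.1.2 \in B', t.2 \in B', t.1.1 <= t.1.2 & t.1.2 <= t.2].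
  rewrite in_fset_filter !in_fsetM.
  by move=> /andP[/andP[/andP[? ?] ?] /andP[? ?]].
have W_bounds x y z : 0 < x -> x <= y -> y <= z -> x < W (x, y, z) <= x + d.
  move=> x0 xy yz; have y0 := lt_le_trans x0 xy; have z0 := lt_le_trans y0 yz.
  have xE : x + d = x * g x by rewrite /g mulrC divfK// gt_eqF.
  rewrite xE /W ltr_pMr// ler_pM2l//= (le_trans (U_le _ _ y0 yz)) ?gM// andbT.
  apply: lt_trans (U_gt _ _ y0 z0); rewrite gE ?addr_gt0// ltrDl.
  by rewrite divr_gt0// addr_gt0.
move=> [[x y] z] [[x' y'] z'] /inP/= [xB yB zB xy yz] /inP/= [xB' yB' zB' xy' yz'].
have x0 := B'gt0 _ xB; have y0 := B'gt0 _ yB; have z0 := B'gt0 _ zB.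
have x0' := B'gt0 _ xB'; have y0' := B'gt0 _ yB'; have z0' := B'gt0 _ zB'.
have /andP[W1 W2] := W_bounds _ _ _ x0 xy yz.
have /andP[W1' W2'] := W_bounds _ _ _ x0' xy' yz'.
move/ln_inj; rewrite !posrE => /(_ (lt_trans x0 W1) (lt_trans x0' W1')) WW'.
have {W1 W2 W1' W2'} xx' : x = x'.
  apply/eqP; rewrite eq_le !leNgt; apply/andP; split; apply/negP => lt.
    have := Bgap _ _ (B'B _ xB') (BA _ (B'B _ xB)) lt; lra.
  have := Bgap _ _ (B'B _ xB) (BA _ (B'B _ xB')) lt; lra.
subst x'; have {WW'} UU' : U y z = U y' z' by apply: (mulfI (lt0r_neq0 x0)).
have U1 := U_gt _ _ y0 z0; have U1' := U_gt _ _ y0' z0'.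
have U2 := U_le _ _ y0 yz; have U2' := U_le _ _ y0' yz'.
(* If y' < y, then y' + e <= y, so U y z <= g y <= g (y' + e) < U y' z', a contradiction; the other
   case is symmetric. *)
have {U1 U2 U1' U2'} yy' : y = y'.
  apply/eqP; rewrite eq_le !leNgt; apply/andP; split; apply/negP => lt.
    have le := B'gap _ _ yB' (B'B _ yB) lt.
    have := gM _ _ (addr_gt0 y0' e_gt0) le; lra.
  have le := B'gap _ _ yB (B'B _ yB') lt.
  have := gM _ _ (addr_gt0 y0 e_gt0) le; lra.
subst y'; have {UU'} hh : h z = h z'.
  by apply: (mulfI (lt0r_neq0 (g_gt0 _ (addr_gt0 y0 e_gt0)))).
have -> // : z = z'.
apply/eqP; rewrite eq_le !leNgt; apply/andP; split; apply/negP => lt.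
  have := h_lt _ _ z0' lt; lra.
have := h_lt _ _ z0 lt; lra.
Qed.

(** * From logarithms to product sets *)

Definition mulset (R : realType) (A B : {fset R}) : {fset R} :=
  [fset (a * b)%R | a in A, b in B]%fset.

Lemma mulsetP (R : realType) (A B : {fset R}) (x : R) :
  reflect (exists a b, [/\ a \in A, b \in B & x = a * b]) (x \in mulset A B).
Proof.
apply: (iffP idP) => [/imfset2P[a aA [b bB ->]]|[a [b [aA bB ->]]]].
  by exists a, b.
by apply: in_imfset2.
Qed.

Lemma ln_mulset (R : realType) (A B : {fset R}) :
  (forall a, a \in A -> 0 < a) -> (forall b, b \in B -> 0 < b) ->
  [fset ln x | x in mulset A B]%fset =
  addset [fset ln a | a in A]%fset [fset ln b | b in B]%fset.
Proof.
move=> A0 B0; apply/fsetP => x; apply/imfsetP/addsetP.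
  move=> [_ /= /mulsetP[a [b [aA bB ->]]] ->].
  exists (ln a), (ln b); rewrite !in_imfset//; split => //.
  by rewrite lnM ?posrE ?(A0 _ aA) ?(B0 _ bB).
move=> [_ [_ [/imfsetP[a /= aA ->] /imfsetP[b /= bB ->] ->]]].
exists (a * b); first by apply/mulsetP; exists a, b.
by rewrite lnM ?posrE ?(A0 _ aA) ?(B0 _ bB).
Qed.

Lemma card_ln (R : realType) (A : {fset R}) :
  (forall a, a \in A -> 0 < a) -> #|` [fset ln a | a in A]%fset| = #|` A|.
Proof.
by move=> A0; apply: card_in_imfset => a b aA bA; apply: ln_inj; rewrite posrE A0.
Qed.

(** Elimination of [m1] and [m2] by the sixth power of the first inequality and the cube of the
    second; c occurs 6 + 3 + 1 times and M occurs 6 + 3 times. *)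
Lemma leq_exp_chain (c n m1 m2 M T : nat) :
  (n ^ 2 <= c * m1 * M -> m1 ^ 2 <= c * m2 * M -> m2 ^ 3 <= c * T ->
   n ^ 12 <= c ^ 10 * T * M ^ 9)%N.
Proof.
move=> le1 le2 le3.
have -> : (n ^ 12 = (n ^ 2) ^ 6)%N by rewrite -expnM.
apply: (@leq_trans ((c * m1 * M) ^ 6)%N); first by rewrite leq_exp2r.
have -> : ((c * m1 * M) ^ 6 = c ^ 6 * M ^ 6 * (m1 ^ 2) ^ 3)%N by ring.
apply: (@leq_trans (c ^ 6 * M ^ 6 * (c * m2 * M) ^ 3)%N).
  by rewrite leq_mul// leq_exp2r.
have -> : (c ^ 6 * M ^ 6 * (c * m2 * M) ^ 3 = c ^ 9 * M ^ 9 * m2 ^ 3)%N by ring.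
apply: leq_trans (leq_mul (leqnn _) le3) _.
by rewrite (_ : c ^ 9 * M ^ 9 * (c * T) = c ^ 10 * T * M ^ 9)%N//; ring.
Qed.

Lemma card_ln_expansion (R : realType) (A : {fset R}) :
  A != fset0 -> (forall a, a \in A -> 0 < a) ->
  let L := [fset ln a | a in A]%fset in
  (#|` A| ^ 12 <= 8 ^ 10 * #|` diffset (sumsn 4 L) (sumsn 3 L)| *
    #|` diffset (addset A A) A| ^ 9)%N.
Proof.
move=> A0 Agt0; set L := [fset ln a | a in A]%fset; cbv zeta.
set T := #|` diffset _ _|; set M := #|` diffset (addset A A) A|.
have [a aA] := fset0Pn _ A0.
have M0 : (0 < M)%N.
  by rewrite cardfs_gt0; apply/fset0Pn; exists (a + a - a); rewrite mem_diffset ?mem_addset.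
have T0 : (0 < T)%N.
  have La : ln a \in L by exact: in_imfset.
  rewrite cardfs_gt0; apply/fset0Pn => /=.
  exists ((ln a + (ln a + (ln a + (ln a + 0)))) - (ln a + (ln a + (ln a + 0)))).
  by apply: mem_diffset; (do !apply: mem_addset); rewrite ?inE.
(* For m > 1 one has m <= 2 (m - 1), so passing from m - 1 to m costs a factor 4, whence the 8. *)
have double m k : (1 < m -> m.-1 ^ 2 <= 2 * (k * M) -> m ^ 2 <= 8 * k * M)%N.
  case: m => [//|m] m1 /=; rewrite -!mulnn; nia.
have [n1|n1] := leqP #|` A| 1.
  have -> : #|` A| = 1%N by apply/eqP; rewrite eqn_leq n1 cardfs_gt0.
  apply: (@leq_exp_chain 8 1 1 1 M T); lia.
have [d [B [d0 BA BdA Bgap /(double _ _ n1) leB]]] := popular_gap A0.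
(* If B has at most one point there is no second level, and the chain is completed with m1 = m2 =
   1. *)
have [B1|B1] := leqP #|` B| 1.
  apply: (@leq_exp_chain 8 _ 1 1 M T); [|lia|lia].
  by apply: leq_trans leB _; rewrite leq_mul// leq_mul.
have B0 : B != fset0 by rewrite -cardfs_gt0 ltnW.
have [e [B' [e0 B'B B'eB B'gap leB']]] := popular_gap B0.
have BM : (#|` diffset (addset B B) B| <= M)%N.
  by apply: fsubset_leq_card; rewrite diffsetS// addsetS.
have {}leB' : (#|` B| ^ 2 <= 8 * #|` B'| * M)%N.
  apply: (double _ _ B1); apply: leq_trans leB' _.
  by rewrite leq_mul// leq_mul.
have leB'' := squeeze Agt0 d0 e0 BA B'B BdA B'eB Bgap B'gap.
apply: (leq_exp_chain leB leB'); apply: leq_trans leB'' _.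
by rewrite leq_mul.
Qed.

Lemma card_products_expansion (R : realType) (A : {fset R}) :
  A != fset0 -> (forall a, a \in A -> 0 < a) ->
  (#|` A| ^ 30 * #|` mulset A A| ^ 6 <=
   8 ^ 10 * #|` addset A A| ^ 27 * #|` mulset (mulset A A) A| ^ 7)%N.
Proof.
move=> A0 Agt0; have := card_ln_expansion A0 Agt0.
set L := [fset ln a | a in A]%fset; cbv zeta.
have AAgt0 x : x \in mulset A A -> 0 < x.
  by move=> /mulsetP[a [b [aA bA ->]]]; rewrite mulr_gt0 ?Agt0.
have cardAA : #|` mulset A A| = #|` addset L L| by rewrite -ln_mulset// card_ln.
have cardAAA : #|` mulset (mulset A A) A| = #|` addset (addset L L) L|.
  rewrite -ln_mulset// -ln_mulset// card_ln// => x /mulsetP[a [b [aA bA ->]]].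
  by rewrite mulr_gt0 ?(AAgt0 _ aA) ?(Agt0 _ bA).
have L0 : L != fset0 by rewrite -cardfs_gt0 card_ln// cardfs_gt0.
(* With L + L as base set the sum is L + L + L, the logarithm of AAA, so the expansion ratio is q /
   P. *)
have := plunnecke_ruzsa L 4 3 (addset_neq0 L0 L0).
have := plunnecke_ruzsa A 2 1 A0.
rewrite cardAA cardAAA (_ : sumsn 2 A = addset A A) /=; last by rewrite /= addset0r.
rewrite addset0r.
have : (0 < #|` A|)%N by rewrite cardfs_gt0.
have : (0 < #|` addset L L|)%N by rewrite cardfs_gt0 addset_neq0.
set n := #|` A|; set M := #|` diffset (addset A A) A|; set T := #|` diffset _ _|.
set P := #|` addset L L|; set q := #|` addset _ L|; set s := #|` addset A A|.
move=> P0 n0 leM leT leE; clearbody n M T P q s.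
have {}leM : (M * n ^ 2 <= s ^ 3)%N by rewrite -(leq_pmul2r n0) -mulnA -expnSr.
have {}leT : (T * P ^ 6 <= q ^ 7)%N by rewrite -(leq_pmul2r P0) -mulnA -expnSr.
have -> : (n ^ 30 * P ^ 6 = n ^ 12 * (n ^ 18 * P ^ 6))%N by ring.
apply: leq_trans (leq_mul leE (leqnn _)) _; move: (8 ^ 10)%N => c.
have -> : (c * T * M ^ 9 * (n ^ 18 * P ^ 6) = c * (M * n ^ 2) ^ 9 * (T * P ^ 6))%N.
  by ring.
rewrite leq_mul// leq_mul//.
by rewrite (_ : s ^ 27 = (s ^ 3) ^ 9)%N ?leq_exp2r// -expnM.
Qed.

(** * Solymosi's bound: rich lines and multiplicative energy *)

Lemma slope_between (R : realFieldType) (l m a x : R) :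
  0 < a -> 0 < x -> l < m -> l * (a + x) < l * a + m * x < m * (a + x).
Proof. by move=> a0 x0 lm; apply/andP; split; nra. Qed.

Definition slope (R : realType) (u : R * R) : R := u.2 / u.1.

(** The line of slope l through the origin is represented by the abscissae of its points in A x
    A. *)
Definition line (R : realType) (A : {fset R}) (l : R) : {fset R} :=
  [fset a in A | l * a \in A]%fset.

(* Solymosi's argument: vector sums of a point on one rich line through the
   origin and a point on the next rich line are distinct and lie strictly
   between the two lines. *)
Lemma card_rich (R : realType) (A : {fset R}) (t : nat) :
  (forall a, a \in A -> 0 < a) ->
  (#|` [fset u in (A `*` A)%fset | (t <= #|` line A (slope u)|)%N]%fset| * t
    <= 2 * #|` addset A A| ^ 2)%N.
Proof.
move=> Agt0; set U := [fset u in _ | _]%fset.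
have UP u : u \in U -> [/\ u.1 \in A, u.2 \in A, (t <= #|` line A (slope u)|)%N &
    u.2 = slope u * u.1].
  rewrite in_fset_filter in_fsetM => /andP[/andP[u1 u2] tu]; split => //.
  by rewrite /slope divfK// gt_eqF// Agt0.
clearbody U; have [->|U0] := eqVneq U fset0; first by rewrite cardfs0.
have tA : (t <= #|` A|)%N.
  have /fset0Pn[u /UP[_ _ tu _]] := U0; apply: leq_trans tu _.
  exact/fsubset_leq_card/fset_sub.
have leA : (#|` A| <= #|` addset A A|)%N.
  apply: leq_card_addset; have /fset0Pn[u /UP[u1 _ _ _]] := U0.
  by apply/fset0Pn; exists u.1.
pose Lam := [fset slope u | u in U]%fset.
have LamP l : l \in Lam -> (t <= #|` line A l|)%N.
  by move=> /imfsetP[u /= /UP[_ _ tu _] ->].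
have Lam0 : Lam != fset0.
  by have /fset0Pn[u uU] := U0; apply/fset0Pn; exists (slope u); exact: in_imfset.
have [M [next [_ _ nextP]]] := fset_successor Lam0.
(* The steepest rich line has no successor and is counted apart: it has at most |A| points, and t <=
   |A| <= |A + A|. *)
rewrite -(cardfsID [fset u in U | slope u == M]%fset U) mulnDl mul2n -addnn.
apply: leq_add.
  rewrite -mulnn leq_mul ?(leq_trans tA)//; apply: leq_trans leA.
  apply: (@leq_card_inj _ _ (fun u => u.1)).
    by move=> u; rewrite in_fsetI => /andP[/UP[]].
  move=> u v; rewrite !in_fsetI => /andP[/UP[_ _ _ uE] +] /andP[/UP[_ _ _ vE] +].
  rewrite !in_fset_filter => /andP[_ /eqP uM] /andP[_ /eqP vM] uv.
  by rewrite [u]surjective_pairing [v]surjective_pairing uE vE uM vM uv.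
set U' := (U `\` _)%fset.
have U'P u : u \in U' -> [/\ u.1 \in A, u.2 = slope u * u.1,
    (t <= #|` line A (next (slope u))|)%N, slope u < next (slope u) &
    forall v, v \in U -> slope u < slope v -> next (slope u) <= slope v].
  rewrite in_fsetD in_fset_filter negb_and => /andP[+ uU]; rewrite uU /= => uM.
  have [|nL un nmin] := nextP (slope u) _ uM; first exact: in_imfset.
  have [u1 _ _ uE] := UP _ uU; split => //; first exact: LamP.
  by move=> v vU uv; apply: nmin => //; exact: in_imfset.
pose J := [fset i in iota 0 t]%fset.
have <- : #|` J| = t by rewrite card_fseq undup_id ?iota_uniq// size_iota.
pose pt (p : R * R * nat) := nth 0 (line A (next (slope p.1))) p.2.
rewrite -mulnn -!card_fsetM.
have ptP u i : u \in U' -> i \in J -> [/\ (i < size (line A (next (slope u))))%N,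
   pt (u, i) \in A & next (slope u) * pt (u, i) \in A].
  move=> /U'P[_ _ tu _ _]; rewrite inE/= mem_iota /= add0n => it.
  have isz := leq_trans it tu; have := mem_nth 0 isz.
  by rewrite -/(pt (u, i)) in_fset_filter => /andP[].
apply: (@leq_card_inj _ _
  (fun p => (p.1.1 + pt p, p.1.2 + next (slope p.1) * pt p))).
  move=> [u i]; rewrite !in_fsetM /= => /andP[uU' iJ].
  have [_ pA npA] := ptP _ _ uU' iJ; have := uU'.
  rewrite in_fsetD => /andP[_ /UP[u1 u2 _ _]].
  by rewrite !mem_addset.
move=> [u i] [v j]; rewrite !in_fsetM /= => /andP[uU' iJ] /andP[vU' jJ].
have [ii pA _] := ptP _ _ uU' iJ; have [jj qA _] := ptP _ _ vU' jJ.
have [u1 uE _ un umin] := U'P _ uU'; have [v1 vE _ vn vmin] := U'P _ vU'.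
have uU : u \in U by move: uU'; rewrite in_fsetD => /andP[].
have vU : v \in U by move: vU'; rewrite in_fsetD => /andP[].
have /andP[uu1 uu2] := slope_between (Agt0 _ u1) (Agt0 _ pA) un.
have /andP[vv1 vv2] := slope_between (Agt0 _ v1) (Agt0 _ qA) vn.
case=> e1 e2.
have pq0 : 0 < u.1 + pt (u, i) by rewrite addr_gt0 ?Agt0.
(* Each sum lies strictly between a line and its successor, and these open sectors are disjoint for
   different slopes. *)
have suv : slope u = slope v.
  apply/eqP; rewrite eq_le !leNgt; apply/andP; split; apply/negP => lt.
    have le := vmin _ uU lt; rewrite -uE e2 e1 vE in uu1.
    have := lt_trans uu1 vv2; rewrite ltr_pM2r -?e1// => h.
    by have := lt_le_trans h le; rewrite ltxx.
  have le := umin _ vU lt; rewrite -vE -e2 -e1 uE in vv1.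
  have := lt_trans vv1 uu2; rewrite ltr_pM2r// => h.
  by have := lt_le_trans h le; rewrite ltxx.
have pq : pt (u, i) = pt (v, j).
  move: e2; rewrite uE vE -suv (_ : u.1 = v.1 + pt (v, j) - pt (u, i)); last first.
    by rewrite -e1 addrK.
  move=> e2; apply: (mulfI (_ : next (slope u) - slope u != 0)).
    by rewrite subr_eq0 gt_eqF.
  lra.
move: e1; rewrite pq => /addIr uv1.
have -> : u = v.
  by rewrite [u]surjective_pairing [v]surjective_pairing uE vE suv uv1.
move: pq ii; rewrite /pt /= suv => /eqP pq ii; move: pq.
by rewrite nth_uniq ?fset_uniq// => /eqP ->.
Qed.

Lemma sqr_sum_leq (I : Type) (s : seq I) (F : I -> nat) :
  ((\sum_(i <- s) F i) ^ 2 <= size s * \sum_(i <- s) F i ^ 2)%N.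
Proof.
elim: s => [|i s IH]; first by rewrite !big_nil.
rewrite !big_cons /=; move: IH; set S := (\sum_(j <- s) F j)%N.
set Q := (\sum_(j <- s) F j ^ 2)%N; move: (F i) (size s) => x m IH.
(* From S^2 <= m Q, the induction hypothesis, and 4 (m x^2) Q <= (m x^2 + Q)^2. *)
have : (2 * (x * S) <= m * x ^ 2 + Q)%N.
  rewrite -leq_sqr; apply: leq_trans (nat_AGM2 _ _).
  have -> : ((2 * (x * S)) ^ 2 = 4 * (x ^ 2 * S ^ 2))%N by ring.
  by rewrite leq_mul2l /= [leqRHS]mulnAC [leqRHS]mulnC leq_mul.
move=> h; rewrite sqrnD; lia.
Qed.

(** Cauchy-Schwarz over the fibres of f: the sum of the squared fibre sizes counts the
    collisions. *)
Lemma collision_bound (T V : choiceType) (f : T -> V) (U : {fset T}) :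
  (#|` U| ^ 2 <= #|` [fset f u | u in U]%fset| *
    #|` [fset p in (U `*` U)%fset | f p.1 == f p.2]%fset|)%N.
Proof.
set Y := [fset f u | u in U]%fset; set E := [fset p in _ | _]%fset.
have fU u : u \in U -> f u \in Y by move=> uU; exact: in_imfset.
have fE p : p \in E -> f p.1 \in Y.
  by rewrite in_fset_filter in_fsetM => /andP[/andP[/fU]].
rewrite (card_fibers fU) (card_fibers fE).
apply: leq_trans (sqr_sum_leq _ _) _; rewrite leq_mul// leq_sum// => y _.
rewrite -mulnn -card_fsetM; apply/fsubset_leq_card/fsubsetP => -[u v].
rewrite in_fsetM !in_fset_filter in_fsetM /=.
by move=> /andP[/andP[-> /eqP ->] /andP[-> /eqP ->]]; rewrite eqxx.
Qed.

(** The term 1/m is at most ln m - ln (m - 1), because ln (1 - 1/m) <= -1/m. *)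
Lemma harmonic_le (R : realType) (n : nat) : (0 < n)%N ->
  \sum_(1 <= t < n.+1) (t%:R : R)^-1 <= 1 + ln n%:R.
Proof.
elim: n => [//|[_ _|n IH _]]; first by rewrite big_nat1 ln1 invr1 addr0.
rewrite big_nat_recr//=; apply: le_trans (lerD (IH _) (lexx _)) _ => //.
rewrite -addrA lerD2l.
have n1 : 0 < n.+1%:R :> R by rewrite ltr0n.
have n2 : 0 < n.+2%:R :> R by rewrite ltr0n.
have n12 : n.+2%:R = n.+1%:R + 1 :> R by rewrite -natr1.
have lt1 : n.+2%:R^-1 < 1 :> R by rewrite invf_lt1// ltr1n.
have := @le_ln1Dx R (- n.+2%:R^-1); rewrite ltrN2 => /(_ lt1).
have -> : 1 - n.+2%:R^-1 = n.+1%:R / n.+2%:R :> R by rewrite n12; field; lra.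
rewrite ln_div ?posrE// => h.
by rewrite -lerBrDl -lerN2 opprB.
Qed.

(** Layer-cake form of r, turning a sum over points into a sum over richness thresholds t. *)
Lemma sum_truncated (r n : nat) : (r <= n)%N ->
  (\sum_(1 <= t < n.+1 | t <= r) 1 = r)%N.
Proof.
move=> rn; have := @big_nat_widen _ 0%N addn 1 r.+1 n.+1 xpredT (fun=> 1%N) rn.
by rewrite sum_nat_const_nat subn1 muln1 => <-.
Qed.

(** Cauchy-Schwarz bounds n^4 by |AA| times the multiplicative energy. Counted by pairs of points of
    equal slope, the energy is cut into thresholds t; each contributes at most 2 |A + A|^2 / t by
    [card_rich], and the harmonic sum gives the logarithm. *)
Lemma solymosi (R : realType) (A : {fset R}) :
  A != fset0 -> (forall a, a \in A -> 0 < a) ->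
  #|` A|%:R ^+ 4 <= 2 * #|` mulset A A|%:R * #|` addset A A|%:R ^+ 2 *
    (1 + ln #|` A|%:R) :> R.
Proof.
move=> A0 Agt0; set S := (A `*` A)%fset; set n := #|` A|.
have n0 : (0 < n)%N by rewrite cardfs_gt0.
pose E := [fset p in (S `*` S)%fset | slope p.1 == slope p.2]%fset.
have le1 : (n ^ 4 <= #|` mulset A A| * #|` E|)%N.
  have -> : (n ^ 4 = #|` S| ^ 2)%N by rewrite card_fsetM -/n; ring.
  apply: leq_trans (collision_bound (fun u => u.1 * u.2) S) _.
  apply: leq_mul.
    apply/fsubset_leq_card/fsubsetP => _ /imfsetP[u /= + ->].
    by rewrite in_fsetM => /andP[u1 u2]; apply/mulsetP; exists u.1, u.2.
  (* The relation a b = c d is read as a / c = d / b, equality of the slopes of (c, a) and (b,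
     d). *)
  apply: (@leq_card_inj _ _ (fun p => ((p.2.1, p.1.1), (p.1.2, p.2.2)))).
    move=> [[a b] [c d]]; rewrite !in_fset_filter !in_fsetM /=.
    move=> /andP[/andP[/andP[aA bA] /andP[cA dA]] /eqP e].
    rewrite aA bA cA dA /= /slope /=.
    have c0 : c != 0 by rewrite gt_eqF// Agt0.
    have b0 : b != 0 by rewrite gt_eqF// Agt0.
    by rewrite eqr_div// e mulrC.
  by move=> [[a b] [c d]] [[a' b'] [c' d']] _ _ [-> -> -> ->].
have le2 : (#|` E| <= \sum_(1 <= t < n.+1)
    #|` [fset u in S | (t <= #|` line A (slope u)|)%N]%fset|)%N.
  have ES p : p \in E -> p.1 \in S.
    by rewrite in_fset_filter in_fsetM => /andP[/andP[]].
  rewrite (card_fibers ES).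
  apply: (@leq_trans (\sum_(u <- S) \sum_(1 <= t < n.+1 |
      (t <= #|` line A (slope u)|)%N) 1)%N).
    rewrite big_seq [leqRHS]big_seq leq_sum// => u uS.
    rewrite sum_truncated; last exact/fsubset_leq_card/fset_sub.
    apply: (@leq_card_inj _ _ (fun p => p.2.1)).
      move=> [v [a b]]; rewrite !in_fset_filter !in_fsetM /=.
      move=> /andP[/andP[/andP[_ /andP[aA bA]] /eqP e] /eqP vu].
      by rewrite aA /= -vu e /slope /= divfK// gt_eqF// Agt0.
    move=> [v [a b]] [v' [a' b']]; rewrite !in_fset_filter !in_fsetM /=.
    move=> /andP[/andP[/andP[_ /andP[aA bA]] /eqP e] /eqP vu].
    move=> /andP[/andP[/andP[_ /andP[aA' bA']] /eqP e'] /eqP vu'] aa.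
    rewrite vu vu' aa; congr (_, (_, _)); move: e e'; rewrite vu vu' => -> /eqP.
    rewrite /slope /= aa -subr_eq0 -mulrBl mulf_eq0 invr_eq0 subr_eq0.
    by rewrite (gt_eqF (Agt0 _ aA')) orbF => /eqP.
  rewrite (exchange_big_dep xpredT)//= leq_sum// => t _.
  by rewrite big_fset_condE -card_fset_sum1.
have le3 : #|` E|%:R <= 2 * #|` addset A A|%:R ^+ 2 * (1 + ln n%:R) :> R.
  apply: (@le_trans _ _ (\sum_(1 <= t < n.+1)
      (2 * #|` addset A A|%:R ^+ 2) * (t%:R : R)^-1)).
    apply: le_trans (_ : (\sum_(1 <= t < n.+1)
      #|` [fset u in S | (t <= #|` line A (slope u)|)%N]%fset|)%N%:R <= _).
      by rewrite ler_nat.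
    rewrite natr_sum big_nat [leRHS]big_nat; apply: ler_sum => t /andP[t0 _].
    rewrite ler_pdivlMr ?ltr0n// -natrX -!natrM ler_nat; exact: card_rich.
  by rewrite -mulr_sumr ler_wpM2l ?harmonic_le.
have := le1; rewrite -(ler_nat R) natrX natrM => /le_trans; apply.
rewrite (_ : 2 * _ * _ * _ = #|` mulset A A|%:R *
  (2 * #|` addset A A|%:R ^+ 2 * (1 + ln n%:R))); last by ring.
by rewrite ler_wpM2l.
Qed.

(** * Reduction to positive elements and conclusion *)

(** B is the larger of the positive parts of A and -A, and the 1 accounts for zero. In the second
    case negation maps B + B into A + A and BBB into AAA. *)
Lemma positive_part (R : realType) (A : {fset R}) :
  exists B : {fset R}, [/\ forall b, b \in B -> 0 < b,
    (#|` A| <= 1 + 2 * #|` B|)%N, (#|` addset B B| <= #|` addset A A|)%N &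
    (#|` mulset (mulset B B) B| <= #|` mulset (mulset A A) A|)%N].
Proof.
pose Bp := [fset a in A | 0 < a]%fset.
pose Bm := [fset a in [fset - a | a in A] | 0 < a]%fset.
have BmP b : b \in Bm -> - b \in A /\ 0 < b.
  rewrite in_fset_filter => /andP[/imfsetP[a /= aA ->] a0].
  by rewrite opprK.
have BpP b : b \in Bp -> b \in A /\ 0 < b.
  by rewrite in_fset_filter => /andP[].
have cardA : (#|` A| <= 1 + #|` Bp| + #|` Bm|)%N.
  have AU : (A `<=` 0 |` Bp `|` [fset (- b)%R | b in Bm])%fset.
    apply/fsubsetP => a aA; rewrite !in_fsetU in_fset1.
    have [a0|a0|->] := ltgtP a 0; last by [].
      apply/orP; right; apply/imfsetP; exists (- a); rewrite ?opprK//=.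
      by rewrite in_fset_filter oppr_gt0 a0 andbT; exact: in_imfset.
    by rewrite in_fset_filter aA a0 orbT.
  apply: leq_trans (fsubset_leq_card AU) _.
  apply: leq_trans (leq_card_fsetU _ _).1 _; apply: leq_add.
    by apply: leq_trans (leq_card_fsetU _ _).1 _; rewrite cardfs1.
  exact: leq_imfset_card.
have [mp|/ltnW pm] := leqP #|` Bm| #|` Bp|.
  exists Bp; split; [by move=> b /BpP[]| | |].
    apply: leq_trans cardA _; rewrite -addnA leq_add2l mul2n -addnn.
    by rewrite leq_add2l.
    by apply/fsubset_leq_card/addsetS; apply/fsubsetP => b /BpP[].
  apply/fsubset_leq_card/fsubsetP => _ /mulsetP[_ [c [/mulsetP[a [b [+ + ->]]] + ->]]].
  move=> /BpP[aA _] /BpP[bA _] /BpP[cA _]; apply/mulsetP.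
  by exists (a * b), c; split => //; apply/mulsetP; exists a, b.
exists Bm; split; [by move=> b /BmP[]| | |].
  apply: leq_trans cardA _; rewrite -addnA leq_add2l mul2n -addnn.
  by rewrite leq_add2r.
  apply: (@leq_card_inj _ _ -%R); last by move=> x y _ _ /oppr_inj.
  move=> _ /addsetP[a [b [/BmP[aA _] /BmP[bA _] ->]]].
  by rewrite opprD; exact: mem_addset.
apply: (@leq_card_inj _ _ -%R); last by move=> x y _ _ /oppr_inj.
move=> _ /mulsetP[_ [c [/mulsetP[a [b [+ + ->]]] + ->]]].
move=> /BmP[aA _] /BmP[bA _] /BmP[cA _]; apply/mulsetP.
exists ((- a) * (- b)), (- c); split => //; last by ring.
by apply/mulsetP; exists (- a), (- b).
Qed.

Lemma leq_card_mulset (R : realType) (A B : {fset R}) :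
  B != fset0 -> (forall b, b \in B -> 0 < b) ->
  (#|` A| <= #|` mulset A B|)%N.
Proof.
move=> /fset0Pn[b bB] Bgt0; apply: (@leq_card_inj _ _ ( *%R^~ b)).
  by move=> a aA; apply/mulsetP; exists a, b.
by move=> x y _ _ /mulIf; apply; rewrite gt_eqF// Bgt0.
Qed.

(** In the application n, s, P, q are the sizes of B, B + B, BB, BBB for the positive part B, and N,
    S, Q those of A, A + A, AAA. Taking logarithms makes the claim linear. *)
Lemma combine_bounds (R : realType) (n N s S P q Q K l lam : R) :
  1 <= n -> 0 < N -> 0 < s -> 0 < P -> 0 < K -> 1 <= l -> 0 < lam ->
  N <= 4 * n -> s <= S -> P <= q -> q <= Q -> N <= S -> S = K * N ->
  lam <= 2 * l ->
  n ^+ 30 * P ^+ 6 <= 8 ^+ 10 * s ^+ 27 * q ^+ 7 ->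
  n ^+ 4 <= 2 * P * s ^+ 2 * lam ->
  2^-1 ^+ 11 * (N `^ (2 + 1 / 392) / K `^ (125 / 56)) / l <= Q.
Proof.
move=> n1 N0 s0 P0 K0 l1 lam0 Nn sS Pq qQ NS SE laml le1 le2.
have n0 := lt_le_trans ltr01 n1; have l0 := lt_le_trans ltr01 l1.
have S0 := lt_le_trans s0 sS; have q0 := lt_le_trans P0 Pq.
have Q0 := lt_le_trans q0 qQ.
have lnle (x y : R) : 0 < x -> x <= y -> ln x <= ln y.
  by move=> x0 xy; rewrite ler_ln ?posrE ?(lt_le_trans x0 xy).
have ln2 : 0 < ln 2 :> R by rewrite ln_gt0// ltr1n.
have p2 : 0 < 2 :> R by [].
have ln4 : ln 4 = 2 * ln 2 :> R.
  by rewrite (_ : 4 = 2 ^+ 2)%R ?lnXn// ?mulr_natl//; ring.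
have ln8 : ln 8 = 3 * ln 2 :> R.
  by rewrite (_ : 8 = 2 ^+ 3)%R ?lnXn// ?mulr_natl//; ring.
have p8 : 0 < 8 :> R by [].
have p4 : 0 < 4 :> R by [].
have lnX (x : R) k : 0 < x -> ln (x ^+ k) = k%:R * ln x.
  by move=> x0; rewrite lnXn// mulr_natl.
have lnMp (x y : R) : 0 < x -> 0 < y -> ln (x * y) = ln x + ln y.
  by move=> x0 y0; rewrite lnM ?posrE.
have XM (x y : R) k m : 0 < x -> 0 < y -> 0 < x ^+ k * y ^+ m.
  by move=> x0 y0; rewrite mulr_gt0 ?exprn_gt0.
have := lnle _ _ (XM _ _ _ _ n0 P0) le1.
rewrite (lnMp (n ^+ 30)) ?exprn_gt0// (lnMp (8 ^+ 10 * _)) ?exprn_gt0 ?XM//.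
rewrite (lnMp (8 ^+ 10)) ?exprn_gt0// !lnX// ln8 => {}le1.
have p2P : 0 < 2 * P by rewrite mulr_gt0.
have := lnle _ _ (exprn_gt0 4 n0) le2.
rewrite (lnMp (2 * P * s ^+ 2)) ?(mulr_gt0 p2P) ?exprn_gt0//.
rewrite (lnMp (2 * P)) ?exprn_gt0// (lnMp 2)// !lnX// => {}le2.
have := lnle _ _ N0 Nn; rewrite lnM ?posrE// ln4 => {}Nn.
have lnsS := lnle _ _ s0 sS; have lnPq := lnle _ _ P0 Pq.
have lnqQ := lnle _ _ q0 qQ; have lnNS := lnle _ _ N0 NS.
have lnlam := lnle _ _ lam0 laml; rewrite lnMp// in lnlam.
rewrite SE lnMp// in lnsS lnNS; have lnl := ln_ge0 l1.
have C0 : 0 < 2^-1 ^+ 11 :> R by rewrite exprn_gt0// invr_gt0.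
have lnC : ln (2^-1 ^+ 11) = - (11 * ln 2) :> R.
  by rewrite lnX ?invr_gt0// lnV ?posrE// mulrN.
move: (2^-1 ^+ 11) C0 lnC => C C0 lnC.
have NK0 := divr_gt0 (powR_gt0 (2 + 1 / 392) N0) (powR_gt0 (125 / 56) K0).
have CNK0 := mulr_gt0 C0 NK0.
have CNKl0 := divr_gt0 CNK0 l0.
rewrite -ler_ln ?posrE// ln_div ?posrE//.
rewrite lnMp// ln_div ?posrE ?powR_gt0// !ln_powR lnC.
(* The first bound with weight 1/392 and the second with weight 391/392 suffice. K gets exponent
   809/392, raised to 125/56 as K >= 1; l gets exponent 391/392 <= 1; the powers of 2 add up to
   4000/392 <= 11, whence the constant. *)
lra.
Qed.

Theorem theorem3p2 (R : realType) :
  exists C c : R, 0 < C /\ 0 < c /\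
    forall (A : {fset R}) (K : R),
      A != fset0 ->
      (#|` sumset A A|)%:R = K * (#|` A|)%:R ->
      gtrsim_with C c
        (#|` triple_prodset A A A|)%:R
        ((#|` A|)%:R `^ (2 + 1 / 392) / K `^ (125 / 56)).
Proof.
exists (2^-1 ^+ 11), 1; split; first by rewrite exprn_gt0// invr_gt0.
split => // A K A0; rewrite /gtrsim_with.
have -> : triple_prodset A A A = mulset (mulset A A) A by [].
have -> : sumset A A = addset A A by [].
set Q := #|` mulset _ A| => KE.
(* For Q <= 1 the conventions make [log2 Q] zero, and with it the whole right-hand side. *)
have [Q1|Q2] := leqP Q 1.
  have -> : log2 (Q%:R : R) = 0.
    move: Q1; rewrite /log2 leq_eqVlt ltnS leqn0.
    move=> /orP[] /eqP ->; first by rewrite ln1 mul0r.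
    by rewrite ln0// mul0r.
  by rewrite powR0 ?oner_neq0// invr0 mulr0.
have ln2 : 0 < ln 2 :> R by rewrite ln_gt0// ltr1n.
have l1 : 1 <= log2 (Q%:R : R).
  by rewrite /log2 ler_pdivlMr// mul1r ler_ln ?posrE ?ltr0n ?ler_nat// ltnW.
rewrite powRr1; last exact: le_trans l1.
(* A singleton has a singleton triple product, so Q >= 2 forces |A| >= 2; then B is nonempty and |A|
   <= 1 + 2 |B| <= 4 |B|. *)
have A2 : (1 < #|` A|)%N.
  rewrite ltnNge; apply/negP => A1.
  have /cardfs1P[a Aa] : #|` A| == 1%N by rewrite eqn_leq A1 cardfs_gt0.
  move: Q2; apply/negP; rewrite -leqNgt /Q -(cardfs1 (a * a * a)).
  apply/fsubset_leq_card/fsubsetP => x.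
  move=> /mulsetP[_ [c [/mulsetP[a' [b [+ + ->]]] + ->]]].
  by rewrite Aa !inE => /eqP -> /eqP -> /eqP ->.
have [B [Bgt0 AB sB pB]] := positive_part A.
have B1 : (0 < #|` B|)%N by lia.
have B0 : B != fset0 by rewrite -cardfs_gt0.
have BBgt0 x : x \in mulset B B -> 0 < x.
  by move=> /mulsetP[a [b [aB bB ->]]]; rewrite mulr_gt0 ?Bgt0.
have BP : (#|` B| <= #|` mulset B B|)%N by exact: leq_card_mulset.
have Pq : (#|` mulset B B| <= #|` mulset (mulset B B) B|)%N.
  exact: leq_card_mulset.
have BQ : (#|` B| <= Q)%N by lia.
have AS : (#|` A| <= #|` addset A A|)%N by exact: leq_card_addset.
have Bs : (#|` B| <= #|` addset B B|)%N by exact: leq_card_addset.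
have K0 : 0 < K.
  have NA0 : 0 < #|` A|%:R :> R by rewrite ltr0n (leq_trans _ A2).
  by rewrite -(pmulr_lgt0 _ NA0) -KE ltr0n (leq_trans _ AS)// (leq_trans _ A2).
(* As ln 2 <= 1, the natural logarithm is at most the binary one here; hence 1 + ln |B| <= 2 log2
   Q. *)
have lnB : ln #|` B|%:R <= log2 (Q%:R : R).
  have lnQ : ln #|` B|%:R <= ln Q%:R :> R by rewrite ler_ln ?posrE ?ltr0n ?ler_nat//; lia.
  have ln21 : ln 2 <= 1 :> R.
    by have := @le_ln1Dx R 1; rewrite (_ : 1 + 1 = 2)//; apply; lra.
  apply: le_trans lnQ _; rewrite /log2 ler_pdivlMr// ler_piMr// ln_ge0// ler1n; lia.
have lnB0 : 0 <= ln #|` B|%:R :> R by rewrite ln_ge0// ler1n.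
have le1 : #|` B|%:R ^+ 30 * #|` mulset B B|%:R ^+ 6 <=
    8 ^+ 10 * #|` addset B B|%:R ^+ 27 * #|` mulset (mulset B B) B|%:R ^+ 7 :> R.
  rewrite -!natrX -!natrM ler_nat; exact: card_products_expansion.
have le2 := solymosi B0 Bgt0.
apply: (combine_bounds _ _ _ _ K0 l1 _ _ _ _ _ _ KE _ le1 le2).
- by rewrite ler1n.
- by rewrite ltr0n; lia.
- by rewrite ltr0n; lia.
- by rewrite ltr0n; lia.
- lra.
- by rewrite -natrM ler_nat; lia.
- by rewrite ler_nat.
- by rewrite ler_nat.
- by rewrite ler_nat.
- by rewrite ler_nat.
- lra.
Qed.
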